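(* Let $r\in\mathbb{R}$. For every integer $n\ge 0$, \[ E_n^{(r)}(x)=n!\sum_{k=0}^{n}\left\{\sum_{\substack{0\le l\le n-k\\ l\ \text{even}}}\frac{E_{n-k-l}^{(r)}}{k!\,(n-k-l)!\,2^{k+l}\,\left(\frac{l}{2}\right)!}\right\}H_k(x). \]
   Context: The Hermite polynomials $H_n(x)$ are defined by $e^{2xt-t^2}=\sum_{n\ge0}H_n(x)\frac{t^n}{n!}$. For $r\in\mathbb{R}$, the Euler polynomials of order $r$ are defined by $\left(\frac{2}{e^t+1}\right)^r e^{xt}=\sum_{n\ge0}E_n^{(r)}(x)\frac{t^n}{n!}$, and the Euler numbers of order $r$ are $E_n^{(r)}=E_n^{(r)}(0)$. *)

(* Defs.v *)
From Stdlib Require Import Reals Factorial ClassicalEpsilon.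
From Coquelicot Require Import Coquelicot.
Open Scope R_scope.

(** [f t = \sum_{n >= 0} a_n t^n / n!] as convergent series, for all [t] in a
    neighbourhood of [0]. *)
Definition is_egf (f : R -> R) (a : nat -> R) : Prop :=
  locally 0 (fun t => is_pseries (fun n => a n / INR (fact n)) t (f t)).

(** A sequence [a] with [is_egf f a] is unique, and exists when [f] is analytic
    at [0]; both generating functions below are. For any other [f] the value is
    unspecified. *)
Definition egf_coef (f : R -> R) : nat -> R :=
  epsilon (inhabits (fun _ => 0)) (is_egf f).

Definition hermite (n : nat) (x : R) : R :=
  egf_coef (fun t => exp (2 * x * t - t ^ 2)) n.

(** The base of [Rpower] is positive for every [t], so this is the usual real
    power. *)
Definition euler (r : R) (n : nat) (x : R) : R :=
  egf_coef (fun t => Rpower (2 / (exp t + 1)) r * exp (x * t)) n.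

Definition euler_number (r : R) (n : nat) : R := euler r n 0.

(* Main.v *)
(** Write [e^(xt) = exp (2 x (t/2) - (t/2)^2) * exp (t^2 / 4)]. Then the
    generating function of [E_n^(r)(x)] is the product of that of the Hermite
    polynomials at [t/2], of [exp (t^2 / 4)] and of that of the Euler numbers,
    and the formula compares the coefficients of [t^n].

    Since [egf_coef] is unspecified for non-analytic functions, the expansions
    have to be shown to exist. For the power [(2 / (e^t + 1))^r] this follows
    from the differential equation [(1 + e^t) y' = - r e^t y]: its recursion for
    the coefficients yields geometric growth, hence a positive radius of
    convergence. *)
Require Import Defs.
From Stdlib Require Import Reals Factorial.
From Stdlib Require Import Lra Lia PeanoNat List ClassicalEpsilon.
From Coquelicot Require Import Coquelicot.
Open Scope R_scope.

(** * Convergent power series expansions at 0 *)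

Definition has_powser (f : R -> R) (a : nat -> R) : Prop :=
  locally 0 (fun t => is_pseries a t (f t)).

Lemma locally_0_iff (P : R -> Prop) :
  locally 0 P <-> exists d, 0 < d /\ forall t, Rabs t < d -> P t.
Proof.
split.
- intros [d Hd]. exists d. split; [apply cond_pos|].
  intros t Ht. apply Hd. unfold ball; simpl.
  unfold AbsRing_ball, abs, minus, plus, opp; simpl.
  now rewrite Ropp_0, Rplus_0_r.
- intros (d & Hd & H). exists (mkposreal d Hd). intros t Ht. apply H.
  revert Ht. unfold ball; simpl.
  unfold AbsRing_ball, abs, minus, plus, opp; simpl.
  now rewrite Ropp_0, Rplus_0_r.
Qed.

Lemma is_pseries_bounded (a : nat -> R) (t l : R) :
  is_pseries a t l -> exists M, forall n, Rabs (a n * t ^ n) <= M.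
Proof.
intros H. apply is_pseries_R in H.
assert (Hl : is_lim_seq (fun n => a n * t ^ n) 0)
  by (apply ex_series_lim_0; now exists l).
apply is_lim_seq_Reals in Hl.
destruct (maj_by_pos (fun n => a n * t ^ n)) as (M & _ & HM).
- now exists 0.
- now exists M.
Qed.

Lemma CV_radius_ge_bounded (a : nat -> R) (t M : R) :
  (forall n, Rabs (a n * t ^ n) <= M) -> Rbar_le t (CV_radius a).
Proof. intros H. apply (proj1 (CV_radius_bounded a)). now exists M. Qed.

(** Convergence at the single point [d / 2] bounds the terms there, which already forces the radius
    to be at least [d / 2]. *)
Lemma has_powser_radius (f : R -> R) (a : nat -> R) :
  has_powser f a -> Rbar_lt 0 (CV_radius a).
Proof.
intros H. apply locally_0_iff in H. destruct H as (d & Hd & H).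
destruct (is_pseries_bounded a (d / 2) (f (d / 2))) as [M HM].
- apply H. rewrite Rabs_pos_eq; lra.
- apply Rbar_lt_le_trans with (d / 2); [simpl; lra|].
  now apply CV_radius_ge_bounded with M.
Qed.

Lemma Rbar_pos_lower (l : Rbar) :
  Rbar_lt 0 l -> exists d, 0 < d /\ forall t, Rabs t < d -> Rbar_lt (Rabs t) l.
Proof.
destruct l as [l| |]; simpl; intros H; try easy.
- now exists l.
- exists 1. split; [lra|easy].
Qed.

Lemma locally_inside_radius (a : nat -> R) :
  Rbar_lt 0 (CV_radius a) ->
  locally 0 (fun t => Rbar_lt (Rabs t) (CV_radius a)).
Proof. intros H. apply locally_0_iff. now apply Rbar_pos_lower. Qed.

Lemma has_powser_unique (f : R -> R) (a b : nat -> R) :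
  has_powser f a -> has_powser f b -> forall n, a n = b n.
Proof.
intros Ha Hb n. apply PSeries_ext_recip.
- now apply has_powser_radius with f.
- now apply has_powser_radius with f.
- generalize (filter_and _ _ Ha Hb). unfold has_powser. apply filter_imp. intros t [H1 H2].
  now rewrite (is_pseries_unique _ _ _ H1), (is_pseries_unique _ _ _ H2).
Qed.

Lemma has_powser_ext (f g : R -> R) (a : nat -> R) :
  (forall t, f t = g t) -> has_powser f a -> has_powser g a.
Proof.
unfold has_powser. intros H. apply filter_imp. intros t Ht. now rewrite <- H.
Qed.

Lemma has_powser_ext_coef (f : R -> R) (a b : nat -> R) :
  (forall n, a n = b n) -> has_powser f a -> has_powser f b.
Proof.
unfold has_powser. intros H. apply filter_imp. intros t.
now apply is_pseries_ext.
Qed.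

(** The Cauchy product needs [t] strictly inside both discs of convergence, so these two
    neighbourhoods are intersected with those where the expansions hold. *)
Lemma has_powser_mult (f g : R -> R) (a b : nat -> R) :
  has_powser f a -> has_powser g b ->
  has_powser (fun t => f t * g t) (PS_mult a b).
Proof.
intros Ha Hb.
generalize (filter_and _ _ (filter_and _ _ Ha Hb)
  (filter_and _ _
    (locally_inside_radius a (has_powser_radius _ _ Ha))
    (locally_inside_radius b (has_powser_radius _ _ Hb)))).
unfold has_powser. apply filter_imp. intros t [[H1 H2] [H3 H4]]. now apply is_pseries_mult.
Qed.

Lemma has_powser_plus (f g : R -> R) (a b : nat -> R) :
  has_powser f a -> has_powser g b ->
  has_powser (fun t => f t + g t) (PS_plus a b).
Proof.
intros Ha Hb. generalize (filter_and _ _ Ha Hb). unfold has_powser. apply filter_imp.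
intros t [H1 H2]. exact (is_pseries_plus a b t _ _ H1 H2).
Qed.

Lemma has_powser_scal (f : R -> R) (a : nat -> R) (c : R) :
  has_powser f a -> has_powser (fun t => c * f t) (PS_scal c a).
Proof.
unfold has_powser. apply filter_imp. intros t.
apply (is_pseries_scal c a t (f t)), Rmult_comm.
Qed.

Lemma has_powser_dilate (f : R -> R) (a : nat -> R) (c : R) :
  has_powser f a -> has_powser (fun t => f (c * t)) (fun n => c ^ n * a n).
Proof.
intros H. apply locally_0_iff in H. destruct H as (d & Hd & H).
(* Adding 1 keeps the divisor positive when [c = 0]. *)
apply locally_0_iff. exists (d / (Rabs c + 1)).
assert (Hc := Rabs_pos c). split; [apply Rdiv_lt_0_compat; lra|].
intros t Ht. apply is_pseries_R.
apply is_series_ext with (fun n => a n * (c * t) ^ n).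
- intros n. rewrite Rpow_mult_distr. simpl. ring.
- apply is_pseries_R, H. rewrite Rabs_mult.
  apply Rle_lt_trans with ((Rabs c + 1) * Rabs t).
  + apply Rmult_le_compat_r; [apply Rabs_pos|lra].
  + apply (Rmult_lt_compat_l (Rabs c + 1)) in Ht; [|lra].
    replace ((Rabs c + 1) * (d / (Rabs c + 1))) with d in Ht by (field; lra).
    exact Ht.
Qed.

(** * Exponential series *)

Lemma has_powser_exp (c : R) :
  has_powser (fun t => exp (c * t)) (fun n => c ^ n * / INR (fact n)).
Proof.
apply (has_powser_dilate exp). apply locally_0_iff. exists 1. split; [lra|].
intros t _. apply is_exp_Reals.
Qed.

Lemma has_powser_exp_sqr (c : R) :
  has_powser (fun t => exp (c * t ^ 2))
    (fun l => if Nat.even l then c ^ (l / 2) * / INR (fact (l / 2)) else 0).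
Proof.
apply locally_0_iff. exists 1. split; [lra|]. intros t _.
(* The series is split by parity: the even part is the exponential series at [c * t ^ 2], and [0] is
   the sum of the odd part. *)
replace (exp (c * t ^ 2)) with (exp (c * t ^ 2) + t * 0) by ring.
apply is_pseries_odd_even; apply is_pseries_R.
- apply is_series_ext with (fun n => / INR (fact n) * (c * t ^ 2) ^ n).
  + intros n. rewrite Nat.even_mul. cbn [Nat.even orb].
    rewrite Nat.mul_comm, Nat.div_mul by lia. rewrite Rpow_mult_distr, <- Rmult_assoc.
    f_equal. apply Rmult_comm.
  + apply is_pseries_R, is_exp_Reals.
- apply is_pseries_R.
  (* The zero series is obtained as 0 times the exponential series, which supplies its
     convergence. *)
  apply is_pseries_ext with (PS_scal 0 (fun n => / INR (fact n))).
  + intros n. rewrite Nat.even_add, Nat.even_mul. apply Rmult_0_l.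
  + assert (H := is_pseries_scal 0 _ (t ^ 2) _ (Rmult_comm _ _)
      (is_exp_Reals (t ^ 2))).
    change (scal 0 (exp (t ^ 2))) with (0 * exp (t ^ 2)) in H.
    now rewrite Rmult_0_l in H.
Qed.

(** * Recursions over all earlier values, and their growth *)

Fixpoint history (w : nat -> nat -> R) (c0 : R) (n : nat) : list R :=
  match n with
  | O => c0 :: nil
  | S m =>
      sum_f_R0 (fun k => w m k * nth k (history w c0 m) 0) m :: history w c0 m
  end.

(** The recursion is not structural, so [history] carries all values computed so far, newest first.
    Position [k] at stage [n] thus holds the value of index [n - k], the one the convolution asks
    for. *)
Lemma nth_history (w : nat -> nat -> R) (c0 : R) (n k : nat) :
  (k <= n)%nat -> nth k (history w c0 n) 0 = hd 0 (history w c0 (n - k)).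
Proof.
revert k. induction n as [|n IH]; intros [|k] Hk; try reflexivity; try lia.
apply IH. lia.
Qed.

Lemma full_history_recursion (w : nat -> nat -> R) (c0 : R) :
  exists c : nat -> R, c 0%nat = c0 /\
    forall n, c (S n) = sum_f_R0 (fun k => w n k * c (n - k)%nat) n.
Proof.
exists (fun n => hd 0 (history w c0 n)). split; [reflexivity|].
intros n. apply sum_eq. intros k Hk. now rewrite nth_history.
Qed.

Lemma geometric_convolution (A C : R) (n : nat) :
  (C - A) * sum_f_R0 (fun k => A ^ k * C ^ (n - k)) n = C ^ S n - A ^ S n.
Proof.
induction n as [|n IH]; [simpl; ring|].
rewrite tech5, Nat.sub_diag, Rmult_plus_distr_l.
rewrite (sum_eq _ (fun k => A ^ k * C ^ (n - k) * C)).
- rewrite <- scal_sum.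
  replace ((C - A) * (C * sum_f_R0 (fun k => A ^ k * C ^ (n - k)) n))
    with (C * ((C - A) * sum_f_R0 (fun k => A ^ k * C ^ (n - k)) n)) by ring.
  rewrite IH. simpl. ring.
- intros k Hk. replace (S n - k)%nat with (S (n - k)) by lia. simpl. ring.
Qed.

(** The ratio [C = A + M] is chosen so that the induction closes: as [M = C - A], the sum of
    [M * A ^ k * C ^ (n - k)] telescopes to [C ^ S n - A ^ S n], which is below [C ^ S n]. *)
Lemma recursion_growth (w : nat -> nat -> R) (c : nat -> R) (M A : R) :
  0 <= M -> 0 < A ->
  (forall n k, (k <= n)%nat -> Rabs (w n k) <= M * A ^ k) ->
  (forall n, c (S n) = sum_f_R0 (fun k => w n k * c (n - k)%nat) n) ->
  forall n, Rabs (c n) <= Rabs (c 0%nat) * (A + M) ^ n.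
Proof.
intros HM HA Hw Hc n.
induction n as [n IH] using (well_founded_induction Wf_nat.lt_wf).
destruct n as [|n]; [simpl; lra|].
rewrite Hc. eapply Rle_trans; [apply Rsum_abs|].
apply Rle_trans with
  (sum_f_R0 (fun k => A ^ k * (A + M) ^ (n - k) * (Rabs (c 0%nat) * M)) n).
- apply sum_Rle. intros k Hk. rewrite Rabs_mult.
  replace (A ^ k * (A + M) ^ (n - k) * (Rabs (c 0%nat) * M))
    with (M * A ^ k * (Rabs (c 0%nat) * (A + M) ^ (n - k))) by ring.
  apply Rmult_le_compat; try apply Rabs_pos.
  + now apply Hw.
  + apply IH. lia.
- rewrite <- scal_sum, Rmult_assoc.
  apply Rmult_le_compat_l; [apply Rabs_pos|].
  replace M with (A + M - A) at 1 by ring.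
  rewrite geometric_convolution. assert (H := pow_lt A (S n) HA). lra.
Qed.

(** * Linear differential equations of first order *)

Lemma has_powser_geometric_bound (f g : R -> R) (a b : nat -> R) :
  has_powser f a -> has_powser g b ->
  exists M A, 0 <= M /\ 0 < A /\
    forall n, Rabs (a n) <= M * A ^ n /\ Rabs (b n) <= M * A ^ n.
Proof.
intros Ha Hb. assert (H := filter_and _ _ Ha Hb).
apply locally_0_iff in H. destruct H as (d & Hd & H).
destruct (H (d / 2)) as [H1 H2]; [rewrite Rabs_pos_eq; lra|].
destruct (is_pseries_bounded _ _ _ H1) as [M1 HM1].
destruct (is_pseries_bounded _ _ _ H2) as [M2 HM2].
assert (bound : forall e N n, Rabs (e * (d / 2) ^ n) <= N ->
          Rabs e <= N * (/ (d / 2)) ^ n).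
{ intros e N n He.
  assert (Hp : 0 < (d / 2) ^ n) by (apply pow_lt; lra).
  rewrite Rabs_mult, (Rabs_pos_eq (_ ^ n)) in He by lra.
  rewrite pow_inv. now apply Rle_div_r. }
(* The ratio is the reciprocal of the point at which both series converge. *)
exists (Rmax M1 M2), (/ (d / 2)). repeat split.
- eapply Rle_trans; [apply Rabs_pos|]. eapply Rle_trans; [apply (HM1 0%nat)|].
  apply Rmax_l.
- apply Rinv_0_lt_compat. lra.
- apply bound. eapply Rle_trans; [apply HM1|apply Rmax_l].
- apply bound. eapply Rle_trans; [apply HM2|apply Rmax_r].
Qed.

(** The factor [INR (n - k)] from differentiation is compensated by the division by [INR (S n)], so
    the weights of the recursion stay below a geometric sequence in [k], uniformly in [n]. *)
Lemma formal_ode_solution (p q : R -> R) (a b : nat -> R) (c0 : R) :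
  has_powser p a -> has_powser q b -> a 0%nat <> 0 ->
  exists c, c 0%nat = c0 /\ Rbar_lt 0 (CV_radius c) /\
    forall n, PS_mult a (PS_derive c) n = PS_mult b c n.
Proof.
intros Ha Hb Ha0.
(* [p Y' = q Y], compared at [t^n] and solved for [c (S n)]. *)
set (w := fun n k => (b k - a (S k) * INR (n - k)) / (a 0%nat * INR (S n))).
destruct (full_history_recursion w c0) as (c & Hc0 & Hc).
destruct (has_powser_geometric_bound _ _ _ _ Ha Hb) as (M & A & HM & HA & Hab).
exists c. split; [exact Hc0|split].
(* In the numerator of [w n k], [b k] contributes [M * A ^ k] and [a (S k)] contributes
   [M * A ^ S k] times at most [INR (S n)]; together this gives the factor [1 + A]. *)
- set (M' := M * (1 + A) / Rabs (a 0%nat)).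
  assert (Ha0' := Rabs_pos_lt _ Ha0).
  assert (HM' : 0 <= M').
  { apply Rmult_le_pos; [|left; now apply Rinv_0_lt_compat].
    apply Rmult_le_pos; lra. }
  assert (Hg : forall n, Rabs (c n) <= Rabs (c 0%nat) * (A + M') ^ n).
  { apply (recursion_growth w); try assumption.
    intros n k Hk. unfold w.
    assert (Hn : 1 <= INR (S n)) by (rewrite S_INR; assert (H := pos_INR n); lra).
    assert (Hk1 : 0 <= INR (n - k) <= INR (S n))
      by (split; [apply pos_INR|apply le_INR; lia]).
    rewrite Rabs_div, Rabs_mult, (Rabs_pos_eq (INR (S n)))
      by (try apply Rmult_integral_contrapositive_currified; lra).
    apply Rle_div_l; [apply Rlt_gt, Rmult_lt_0_compat; lra|].
    replace (M' * A ^ k * (Rabs (a 0%nat) * INR (S n)))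
      with (M * A ^ k * INR (S n) + M * A ^ S k * INR (S n))
      by (unfold M'; simpl; field; lra).
    assert (P1 : 0 <= M * A ^ k)
      by (apply Rmult_le_pos; [|apply pow_le]; lra).
    assert (P2 : 0 <= M * A ^ S k)
      by (apply Rmult_le_pos; [|apply pow_le]; lra).
    unfold Rminus. eapply Rle_trans; [apply Rabs_triang|].
    rewrite Rabs_Ropp, Rabs_mult, (Rabs_pos_eq (INR (n - k))) by lra.
    apply Rplus_le_compat.
    - eapply Rle_trans; [apply Hab|]. nra.
    - apply Rmult_le_compat; try apply Rabs_pos; try apply Hk1. apply Hab. }
  assert (Hp : 0 < / (A + M')) by (apply Rinv_0_lt_compat; lra).
  apply Rbar_lt_le_trans with (/ (A + M')); [exact Hp|].
  apply CV_radius_ge_bounded with (Rabs (c 0%nat)). intros n.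
  assert (Hq : 0 < (A + M') ^ n) by (apply pow_lt; lra).
  rewrite pow_inv, Rabs_mult, (Rabs_pos_eq (/ _))
    by (left; now apply Rinv_0_lt_compat).
  apply Rle_div_l; [exact Hq|apply Hg].
- intros n. unfold PS_mult, PS_derive.
  assert (Hn : INR (S n) <> 0) by (apply not_0_INR; lia).
  assert (Hlead : a 0%nat * (INR (S n) * c (S n)) =
    sum_f_R0 (fun k => b k * c (n - k)%nat) n -
    sum_f_R0 (fun k => a (S k) * (INR (n - k) * c (n - k)%nat)) n).
  { rewrite Hc, <- minus_sum.
    rewrite (sum_eq (fun l => _ - _)
      (fun k => w n k * c (n - k)%nat * (a 0%nat * INR (S n)))).
    - rewrite <- scal_sum. ring.
    - intros k _. unfold w. field. now split. }
  destruct n as [|n].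
  + simpl in *. lra.
  + rewrite decomp_sum by lia. rewrite Nat.sub_0_r, Hlead.
    (* The sum in [Hlead] has one term more than the tail of the product; that last term carries the
       factor [INR 0] and vanishes. *)
    rewrite (tech5 (fun k => a (S k) * _)). rewrite Nat.sub_diag.
    replace (pred (S n)) with n by reflexivity.
    rewrite (sum_eq (fun i => a (S i) * (INR (S (S n - S i)) * _))
      (fun k => a (S k) * (INR (S n - k) * c (S n - k)%nat))).
    * change (INR 0) with 0. ring.
    * intros k Hk. now replace (S (S n - S k)) with (S n - k)%nat by lia.
Qed.

Lemma has_powser_PSeries (a : nat -> R) :
  Rbar_lt 0 (CV_radius a) -> has_powser (PSeries a) a.
Proof.
intros H. generalize (locally_inside_radius a H). unfold has_powser. apply filter_imp.
intros t Ht. now apply PSeries_correct, CV_radius_inside.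
Qed.

Lemma is_derive_zero_const_near_0 (f : R -> R) (d : R) :
  (forall t, Rabs t < d -> is_derive f t 0) ->
  forall t, Rabs t < d -> f t = f 0.
Proof.
intros H t Ht. destruct (Rtotal_order t 0) as [H0|[->|H0]].
- apply (eq_is_derive f); [|exact H0].
  intros s Hs. apply H. rewrite Rabs_left1 in Ht |- * by lra. lra.
- reflexivity.
- symmetry. apply (eq_is_derive f); [|exact H0].
  intros s Hs. apply H. rewrite Rabs_pos_eq in Ht |- * by lra. lra.
Qed.

(** Analyticity of [y] is not assumed but derived: the sum of the formal solution satisfies the same
    equation near 0, so its quotient by [y] has derivative zero there. The quotient is then
    constant, and equals 1 because the values at 0 agree. *)
Lemma has_powser_ode (p q y y' : R -> R) (a b : nat -> R) :
  has_powser p a -> has_powser q b ->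
  (forall t, p t <> 0) -> (forall t, y t <> 0) ->
  (forall t, is_derive y t (y' t)) ->
  (forall t, p t * y' t = q t * y t) ->
  exists c, has_powser y c.
Proof.
intros Ha Hb Hp Hy Hd Hode.
assert (Ha0 : a 0%nat <> 0).
{ assert (H := locally_singleton _ _ Ha). simpl in H.
  apply is_pseries_unique in H. rewrite PSeries_0 in H. rewrite H. apply Hp. }
destruct (formal_ode_solution p q a b (y 0) Ha Hb Ha0) as (c & Hc0 & Hr & Hc).
exists c.
assert (HY := has_powser_PSeries c Hr).
assert (Hr' : Rbar_lt 0 (CV_radius (PS_derive c))) by now rewrite CV_radius_derive.
assert (HY' := has_powser_PSeries _ Hr').
assert (Hall := filter_and _ _
  (filter_and _ _ (has_powser_mult _ _ _ _ Ha HY') (has_powser_mult _ _ _ _ Hb HY))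
  (filter_and _ _ HY (locally_inside_radius c Hr))).
apply locally_0_iff in Hall. destruct Hall as (d & Hdpos & Hall).
apply locally_0_iff. exists d. split; [exact Hdpos|].
intros t Ht.
enough (E : PSeries c t = y t) by (rewrite <- E; now apply Hall).
assert (Hq : PSeries c t / y t = PSeries c 0 / y 0).
{ apply (is_derive_zero_const_near_0 (fun s => PSeries c s / y s) d); [|exact Ht].
  clear t Ht. intros t Ht. destruct (Hall t Ht) as [[H1 H2] [_ H4]].
  assert (E : p t * PSeries (PS_derive c) t = q t * PSeries c t).
  { apply is_pseries_unique in H1, H2. rewrite <- H1, <- H2.
    now apply PSeries_ext. }
  replace 0 with
    ((PSeries (PS_derive c) t * y t - PSeries c t * y' t) / y t ^ 2).
  - apply is_derive_div; [now apply is_derive_PSeries|apply Hd|apply Hy].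
  - replace (PSeries (PS_derive c) t) with (q t * PSeries c t / p t)
      by (rewrite <- E; field; apply Hp).
    replace (y' t) with (q t * y t / p t)
      by (rewrite <- Hode; field; apply Hp).
    field. split; [apply Hp|apply Hy]. }
rewrite PSeries_0, Hc0 in Hq.
replace (PSeries c t) with (PSeries c t / y t * y t) by (field; apply Hy).
rewrite Hq. field. apply Hy.
Qed.

(** * Expansions of the two generating functions *)

Lemma has_powser_euler_base (r : R) :
  exists c, has_powser (fun t => Rpower (2 / (exp t + 1)) r) c.
Proof.
assert (He : has_powser exp (fun n => 1 ^ n * / INR (fact n))).
{ apply has_powser_ext with (fun t => exp (1 * t)); [|apply has_powser_exp].
  intros t. now rewrite Rmult_1_l. }
(* The constant 1 is written [exp (0 * t)], so that its expansion is an instance of the exponential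
   one. *)
assert (Hp : has_powser (fun t => exp (0 * t) + exp t) _)
  by exact (has_powser_plus _ _ _ _ (has_powser_exp 0) He).
apply (has_powser_ode _ _ _
  (fun t => - r * exp t / (exp t + 1) * Rpower (2 / (exp t + 1)) r)
  _ _ Hp (has_powser_scal _ _ (- r) He)).
- intros t. assert (H1 := exp_pos (0 * t)). assert (H2 := exp_pos t). lra.
- intros t. unfold Rpower. apply Rgt_not_eq, exp_pos.
- intros t. assert (H2 := exp_pos t). unfold Rpower. auto_derive.
  + repeat split; try lra. apply Rdiv_lt_0_compat; lra.
  + unfold Rdiv. field. lra.
- intros t. assert (H2 := exp_pos t). rewrite Rmult_0_l, exp_0. field. lra.
Qed.

(** One convergent expansion is enough to compute [egf_coef]: it shows that the choice meets its
    specification, and uniqueness of coefficients identifies the chosen sequence. *)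
Lemma egf_coef_powser (f : R -> R) (c : nat -> R) (n : nat) :
  has_powser f c -> egf_coef f n = INR (fact n) * c n.
Proof.
intros Hc.
assert (Hspec : is_egf f (egf_coef f)).
{ apply (epsilon_spec (inhabits (fun _ => 0)) (is_egf f)). exists (fun n => INR (fact n) * c n).
  refine (has_powser_ext_coef _ _ _ _ Hc).
  intros k. field. apply INR_fact_neq_0. }
rewrite <- (has_powser_unique f _ _ Hspec Hc n). field. apply INR_fact_neq_0.
Qed.

Lemma has_powser_hermite (x : R) :
  has_powser (fun t => exp (2 * x * t - t ^ 2))
    (fun n => hermite n x / INR (fact n)).
Proof.
assert (H := has_powser_mult _ _ _ _
  (has_powser_exp (2 * x)) (has_powser_exp_sqr (-1))).
apply has_powser_ext with (g := fun t => exp (2 * x * t - t ^ 2)) in H.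
- refine (has_powser_ext_coef _ _ _ _ H). intros n.
  unfold hermite. rewrite (egf_coef_powser _ _ n H). field.
  apply INR_fact_neq_0.
- intros t. rewrite <- exp_plus. f_equal. ring.
Qed.

Lemma has_powser_euler (r x : R) :
  has_powser (fun t => Rpower (2 / (exp t + 1)) r * exp (x * t))
    (fun n => euler r n x / INR (fact n)).
Proof.
destruct (has_powser_euler_base r) as [c Hc].
assert (H := has_powser_mult _ _ _ _ Hc (has_powser_exp x)).
refine (has_powser_ext_coef _ _ _ _ H). intros n.
unfold euler. rewrite (egf_coef_powser _ _ n H). field.
apply INR_fact_neq_0.
Qed.

Theorem theorem1 (r : R) (n : nat) (x : R) :
  euler r n x =
    INR (fact n) *
    sum_f_R0
      (fun k =>
         sum_f_R0
           (fun l =>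
              if Nat.even l then
                euler_number r (n - k - l)
                / (INR (fact k) * INR (fact (n - k - l)) * 2 ^ (k + l)
                   * INR (fact (l / 2)))
              else 0)
           (n - k)
         * hermite k x)
      n.
Proof.
(* The nesting fixes the shape of the double sum: [k] indexes the Hermite factor, [l] the factor
   [exp (/ 4 * t ^ 2)], and [n - k - l] is left for the Euler numbers. *)
assert (H := has_powser_mult _ _ _ _
  (has_powser_dilate _ _ (/ 2) (has_powser_hermite x))
  (has_powser_mult _ _ _ _ (has_powser_exp_sqr (/ 4)) (has_powser_euler r 0))).
apply has_powser_ext
  with (g := fun t => Rpower (2 / (exp t + 1)) r * exp (x * t)) in H.
- unfold euler at 1. rewrite (egf_coef_powser _ _ n H). f_equal.
  apply sum_eq. intros k Hk. unfold PS_mult.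
  rewrite (Rmult_comm _ (hermite k x)), !scal_sum.
  apply sum_eq. intros l Hl. unfold euler_number.
  destruct (Nat.even l) eqn:El; [|ring].
  (* For even [l] the halving is exact; the resulting power of 1/2 joins the [(/ 2) ^ k] of the
     dilation to form [2 ^ (k + l)]. *)
  assert (E4 : (/ 4) ^ (l / 2) = (/ 2) ^ l).
  { apply Nat.even_spec in El. destruct El as [m ->].
    rewrite Nat.mul_comm, Nat.div_mul by lia.
    rewrite Nat.mul_comm, pow_mult. f_equal. simpl. field. }
  rewrite E4, pow_add, !pow_inv. field.
  repeat split; try apply INR_fact_neq_0; apply pow_nonzero; lra.
- intros t.
  (* The summand [0 * t] matches the exponential in the generating function of the Euler numbers,
     taken at [x = 0]. *)
  replace (x * t) with (2 * x * (/ 2 * t) - (/ 2 * t) ^ 2 + / 4 * t ^ 2 + 0 * t)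
    by field.
  rewrite !exp_plus. ring.
Qed.
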